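(* Assume that $G$ is a finitely generated extension $1\to K\to G\to N\to 1$ where $K$ is abelian and $N$ is abelian with $\mathbb{Q}$-rank $d$. Then $$B(G)\geq \frac{1}{d+2}.$$ In particular, $B(G)>0$ for any finitely generated metabelian group $G$.
   Context: The $\mathbb{Q}$-rank of an abelian group $N$ is $\dim_{\mathbb{Q}}(N\otimes\mathbb{Q})$. Let $S$ be a finite symmetric generating subset of $G$ and $|g|_S=\inf\{n\in\mathbb{N}: g\in S^n\}$. For an isometric linear representation $\pi$ of $G$ on a Hilbert space $\mathcal{H}$ (of the form $L^2(X,m)$), $Z^1(G,\pi)$ is the set of maps $b:G\to \mathcal{H}$ with $b(gh)=\pi(g)b(h)+b(g)$ for all $g,h\in G$. The compression of $b$ is $\rho(t)=\inf_{|g|_S\geq t}\|b(g)\|\in[0,\infty]$. $\rho(t)\succeq t^\alpha$ means that there exists $C>0$ such that $t^\alpha=O(\rho(Ct))$ as $t\to\infty$. $B_\pi(G)$ is the supremum of all $\alpha$ such that there exists $b\in Z^1(G,\pi)$ whose compression satisfies $\rho(t)\succeq t^\alpha$, and $B(G)=B_2(G)$ (the equivariant Hilbert compression rate) is the supremum of $B_\pi(G)$ over all such $\pi$. *)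

(* Defs.v *)
From HB Require Import structures.
From mathcomp Require Import all_boot all_order all_algebra.
From mathcomp Require Import all_classical all_reals all_analysis.

Set Implicit Arguments.
Unset Strict Implicit.
Unset Printing Implicit Defensive.

Import Order.TTheory GRing.Theory Num.Theory.
Import numFieldNormedType.Exports.

Local Open Scope classical_set_scope.
Local Open Scope ring_scope.

(* MathComp groups are multiplicative (groupType) in general and additive
   (zmodType) when abelian; all groups below may be infinite. *)

Section Groups.
Variable G : groupType.

Definition is_subgroup (H : set G) : Prop :=
  [/\ H 1%g,
      forall x y, H x -> H y -> H (x * y)%g
    & forall x, H x -> H x^-1%g].

Definition generated (A : set G) : set G := smallest is_subgroup A.

Definition derived_subgroup : set G :=
  generated [set [~ x, y]%g | x in setT & y in setT].

Definition metabelian : Prop :=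
  forall x y, derived_subgroup x -> derived_subgroup y -> commute x y.

Definition finite_symmetric_generating (S : set G) : Prop :=
  [/\ finite_set S,
      forall s, S s -> S s^-1%g
    & generated S = [set: G]].

Fixpoint set_pow (S : set G) (n : nat) : set G :=
  if n is n'.+1 then [set (x * y)%g | x in S & y in set_pow S n']
  else [set 1%g].

(* Extended-real valued: an element outside the generated submonoid gets
   length +oo (this does not occur when S is symmetric and generating). *)
Definition word_length (R : realType) (S : set G) (g : G) : \bar R :=
  ereal_inf [set (n%:R)%:E | n in [set n : nat | set_pow S n g]].

End Groups.

(* The short exact sequence 1 -> K -> G -> N -> 1 with K and N abelian. *)
Definition abelian_extension (K : zmodType) (G : groupType) (N : zmodType)
    (i : K -> G) (p : G -> N) : Prop :=
  [/\ (forall x y, i (x + y) = (i x * i y)%g) /\ injective i,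
      (forall g h, p (g * h)%g = p g + p h) /\ (forall n, exists g, p g = n)
    & range i = [set g | p g = 0]].

Definition biadditive (A B W : zmodType) (f : A -> B -> W) : Prop :=
  (forall x y b, f (x + y) b = f x b + f y b) /\
  (forall a x y, f a (x + y) = f a x + f a y).

(* (V, t) is the tensor product of N and Q over Z, given by its universal
   property, with Q acting on the second factor. *)
Definition is_tensorQ (N : zmodType) (V : lmodType rat) (t : N -> rat -> V)
  : Prop :=
  [/\ biadditive t,
      forall n (a b : rat), t n (a * b) = a *: t n b
    & forall (W : zmodType) (f : N -> rat -> W), biadditive f ->
        exists! h : V -> W,
          (forall u v, h (u + v) = h u + h v) /\ (forall n a, h (t n a) = f n a)].

Definition has_Q_rank (N : zmodType) (d : nat) : Prop :=
  exists (V : vectType rat) (t : N -> rat -> V),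
    is_tensorQ t /\ \dim {:V}%VS = d.

(* Elements of L^2(X, m) are represented by square-integrable functions, and
   equality in L^2(X, m) is equality m-almost everywhere: unlike the quotient
   LspaceType2, the type of representatives carries its vector space
   operations.  Scalars are real. *)
Definition L2 (dX : measure_display) (X : measurableType dX) (R : realType)
    (m : {measure set X -> \bar R}) := LfunType m (lee1n 2).

Section Compression.
Context (R : realType) (G : groupType).
Context (dX : measure_display) (X : measurableType dX).
Context (m : {measure set X -> \bar R}).

Definition L2_eq (u v : L2 m) : Prop := (u : X -> R) = v %[ae m].

Definition L2_norm (u : L2 m) : \bar R := 'N[m]_2%:E [EFin \o u].

(* Compatibility with L2_eq is a consequence of linearity and isometry. *)
Record L2_rep := {
  rep_fun :> G -> L2 m -> L2 m;
  rep1 : forall u, L2_eq (rep_fun 1%g u) u;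
  repM : forall g h u, L2_eq (rep_fun (g * h)%g u) (rep_fun g (rep_fun h u));
  rep_linear : forall g (a : R) u v,
    L2_eq (rep_fun g (a *: u + v)) (a *: rep_fun g u + rep_fun g v);
  rep_isometry : forall g u, L2_norm (rep_fun g u) = L2_norm u
}.

Definition cocycle (pi : L2_rep) (b : G -> L2 m) : Prop :=
  forall g h, L2_eq (b (g * h)%g) (pi g (b h) + b g).

Definition compression (S : set G) (b : G -> L2 m) (t : R) : \bar R :=
  ereal_inf [set L2_norm (b g) | g in [set g | (t%:E <= word_length R S g)%E]].

Definition dominates_power (rho : R -> \bar R) (a : R) : Prop :=
  exists2 C : R, 0 < C &
  exists2 M : R, 0 < M &
    \forall t \near +oo, ((t `^ a)%R%:E <= M%:E * rho (C * t)%R)%E.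

Definition compression_rate_rep (S : set G) (pi : L2_rep) : \bar R :=
  ereal_sup [set a%:E | a in [set a : R | exists b : G -> L2 m,
    cocycle pi b /\ dominates_power (compression S b) a]].

End Compression.

(* B(G), computed with respect to the generating set S. *)
Definition Hilbert_compression_rate (R : realType) (G : groupType) (S : set G)
  : \bar R :=
  ereal_sup [set r | exists (dX : measure_display) (X : measurableType dX)
    (m : {measure set X -> \bar R}) (pi : L2_rep G m),
    r = compression_rate_rep S pi].

(* Main.v *)
(** Let [L = 2 ^ k].  In [N], spanned up to a finite set by [d] elements, the boxes
    [D_j] of side proportional to [L + j] have cardinality [O(L ^ d)], and
    [#|D_L| = O(#|D_0|)].  Fix a section of [G -> N] of minimal length; the associated
    Schreier generators attached to [D_L] are [O(L ^ d)] commuting elements of the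
    kernel, of length [O(L)], so the set [P_n] of products of at most [n] of them has at
    most [(n + 1) ^ O(L ^ d)] elements.  By pigeonhole some [n = O(L ^ d.+1 * log L)] has
    [#|P_(n + L)| <= 2 * #|P_n|].  The sets [E_j] of elements of [P_(n + j)] times a lift of an
    element of [D_j], [j <= L], then satisfy [E_j S <= E_j.+1] and [#|E_L| = O(#|E_0|)], and
    [E_L] lies in a ball of radius [r_k = O(L ^ (d + 2) * log L)].  The function
    [f_k = \sum_(j < L) 1_(E_j)] changes by at most [1], and only on [E_L], under right
    translation by a generator, whereas [f_k] and its translate by [g] are disjoint as
    soon as [g] has length more than [2 * r_k].  The direct sum over [k] of the
    coboundaries of the functions [z ^- k * f_k / sqrt #|E_0|], with [z > 1] close to [1],
    is a cocycle for a multiple of the right regular representation, whose compression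
    exponent is as close to [1 / (d + 2)] as desired. *)

From HB Require Import structures.
Require Import Defs.
From mathcomp Require Import all_boot all_order all_algebra.
From mathcomp Require Import finmap ring lra zify.
From mathcomp Require Import all_classical all_reals all_analysis.
From mathcomp Require Import measurable_realfun.

Set Implicit Arguments.
Unset Strict Implicit.
Unset Printing Implicit Defensive.

Import Order.TTheory GRing.Theory Num.Theory.
Import numFieldNormedType.Exports.

Local Open Scope classical_set_scope.
Local Open Scope ring_scope.

(** * Counting measure and the regular representation *)

Section CountingSeq.
Context (R : realType) (T : choiceType).

Lemma counting_le_size (A : set T) (s : seq T) :
  A `<=` [set` s] -> (counting A <= (size s)%:R%:E :> \bar R)%E.
Proof.
move=> As; have fA : finite_set A by apply: sub_finite_set As _; exact: finite_seq.
rewrite /counting asboolT// lee_fin ler_nat.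
apply: uniq_leq_size => [|x]; first exact: fset_uniq.
by rewrite in_fset_set// inE => /As.
Qed.

Lemma size_le_counting (A : set T) (s : seq T) :
  uniq s -> [set` s] `<=` A -> ((size s)%:R%:E <= counting A :> \bar R)%E.
Proof.
move=> us sA; rewrite /counting; case: ifPn => [/asboolP fA|_]; last exact: leey.
rewrite lee_fin ler_nat.
by apply: uniq_leq_size => // x xs; rewrite in_fset_set// inE; apply: sA.
Qed.

Lemma counting_preimage_bij (f g : T -> T) (A : set T) :
  cancel f g -> cancel g f -> counting (f @^-1` A) = counting A :> \bar R.
Proof.
move=> fK gK.
have E : f @^-1` A = g @` A.
  apply/seteqP; split => x /=; first by move=> Afx; exists (f x).
  by move=> [y Ay <-]; rewrite gK.
rewrite /counting E; have [fA|fA] := pselect (finite_set A).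
  rewrite !asboolT//; last exact: finite_image.
  rewrite fset_set_image// card_imfset//; exact: can_inj gK.
rewrite !asboolF// => fgA; apply: fA.
have -> : A = f @` (g @` A).
  by rewrite image_comp (_ : f \o g = id) ?image_id//; apply/funext => x /=.
exact: finite_image.
Qed.
End CountingSeq.

(* The space carrying countably many copies of the right regular representation. *)
Definition copies (G : groupType) : Type := (nat * G)%type.

Section Copies.
Variable G : groupType.
HB.instance Definition _ := Choice.on (copies G).
HB.instance Definition _ := isPointed.Build (copies G) (0%N, 1%g).
HB.instance Definition _ := @isMeasurable.Build default_measure_display
  (copies G) discrete_measurable discrete_measurable0
  discrete_measurableC discrete_measurableU.

Lemma copies_measurable (A : set (copies G)) : measurable A.
Proof. by []. Qed.

Definition translate (g : G) (x : copies G) : copies G := (x.1, x.2 * g)%g.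

Lemma translateK g : cancel (translate g) (translate g^-1%g).
Proof. by case=> k x; rewrite /translate /= mulgK. Qed.

Lemma translateVK g : cancel (translate g^-1%g) (translate g).
Proof. by case=> k x; rewrite /translate /= mulgVK. Qed.

Variable R : realType.
Local Notation m := (counting : {measure set (copies G) -> \bar R}).

Lemma integral_translate (g : G) (F : copies G -> \bar R) :
  (forall x, 0 <= F x)%E ->
  (\int[m]_x F (translate g x) = \int[m]_x F x)%E.
Proof.
move=> F0.
have mt : measurable_fun [set: copies G] (translate g) by [].
have mF : measurable_fun [set: copies G] F by [].
have := ge0_integral_pushforward mt m (copies_measurable setT) mF (fun x _ => F0 x).
rewrite preimage_setT => <-.
apply: eq_measure_integral => A _ _.
exact: (counting_preimage_bij R A (translateK g) (translateVK g)).
Qed.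

Lemma L2_normE (f : copies G -> R) :
  ('N[m]_2%:E[EFin \o f] = (\int[m]_x ((f x) ^+ 2)%:E) `^ 2^-1)%E.
Proof.
rewrite unlock; congr (_ `^ _)%E; apply: eq_integral => x _ /=.
by rewrite -[RHS]/(((f x) ^+ 2)%:E) -(real_normK (num_real (f x))) powR_mulrn.
Qed.

Lemma L2_memE (f : copies G -> R) :
  (\int[m]_x ((f x) ^+ 2)%:E < +oo)%E -> f \in Lfun m 2%:E.
Proof.
move=> h; rewrite inE; apply/andP; split; rewrite inE/=; first by [].
by rewrite /finite_norm L2_normE poweR_lty.
Qed.
End Copies.

(** * Right translation on L2 and formal coboundaries *)

Section RegularRep.
Variables (R : realType) (G : groupType).
Local Notation m := (counting : {measure set (copies G) -> \bar R}).

Lemma translate1 x : translate 1%g x = x :> copies G.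
Proof. by case: x => k x; rewrite /translate /= mulg1. Qed.

Lemma translateM g h x : translate (g * h)%g x = translate h (translate g x) :> copies G.
Proof. by rewrite /translate /= mulgA. Qed.

Lemma Lnorm_translate g (u : copies G -> R) :
  ('N[m]_2%:E[EFin \o (u \o translate g)] = 'N[m]_2%:E[EFin \o u])%E.
Proof.
rewrite !L2_normE; congr (_ `^ _)%E.
by apply: (integral_translate g (F := fun x => (u x ^+ 2)%:E)) => x; rewrite lee_fin sqr_ge0.
Qed.

Lemma translate_mem g (u : copies G -> R) :
  u \in Lfun m 2%:E -> u \o translate g \in Lfun m 2%:E.
Proof.
rewrite !inE => /andP[_]; rewrite inE/= => fu; apply/andP; split; rewrite inE//=.
by rewrite /finite_norm Lnorm_translate.
Qed.

Definition L2_of (u : copies G -> R) (hu : u \in Lfun m 2%:E) : L2 m :=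
  Lfun_Sub (lee1n 2) hu.

Definition regular_fun (g : G) (u : L2 m) : L2 m :=
  L2_of (translate_mem g (LfunP u)).

Lemma L2_eqW (u v : L2 m) : (forall x, u x = v x) -> L2_eq u v.
Proof. by move=> uv; apply: nearW => x _; exact: uv. Qed.

Definition regular_rep : L2_rep G m.
Proof.
exists regular_fun.
- by move=> u; apply: L2_eqW => x /=; rewrite translate1.
- by move=> g h u; apply: L2_eqW => x /=; rewrite translateM.
- by move=> g a u v; apply: L2_eqW => x.
- by move=> g u; exact: Lnorm_translate.
Defined.

(** The function [u] itself may fail to be square-integrable; this is what allows the formal
    coboundary to be an unbounded cocycle. *)
Definition coboundary (u : copies G -> R) (g : G) : copies G -> R :=
  u \o translate g - u.

Lemma coboundaryM u g h :
  coboundary u (g * h)%g = coboundary u h \o translate g + coboundary u g.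
Proof.
by apply/funext => x; rewrite /coboundary !fctE/= translateM addrA subrK.
Qed.

(** By the cocycle identity and the translation invariance of the norm, the [g] with
    square-integrable coboundary form a subgroup, so generators decide. *)
Lemma coboundary_mem (S : set G) u : generated S = [set: G] ->
  (forall s, S s -> coboundary u s \in Lfun m 2%:E) ->
  forall g, coboundary u g \in Lfun m 2%:E.
Proof.
move=> gS hS g.
have : generated S g by rewrite gS.
move=> /(_ [set g | coboundary u g \in Lfun m 2%:E]); apply.
split => //; split => /= [|x y xL yL|x xL].
- have -> : coboundary u 1%g = 0.
    by apply/funext => x; rewrite /coboundary !fctE/= translate1 subrr.
  exact: (LfunP (0 : L2 m)).
- rewrite coboundaryM; exact: (LfunP (L2_of (translate_mem x yL) + L2_of xL)).
- have -> : coboundary u x^-1%g = - (coboundary u x \o translate x^-1%g).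
    by apply/funext => y; rewrite /coboundary !fctE/= translateVK opprB.
  exact: (LfunP (- L2_of (translate_mem x^-1%g xL))).
Qed.

Lemma coboundary_cocycle u (hu : forall g, coboundary u g \in Lfun m 2%:E) :
  cocycle regular_rep (fun g => L2_of (hu g)).
Proof.
move=> g h; apply: L2_eqW => x.
by rewrite [LHS]/= coboundaryM.
Qed.

Lemma integral_copies_le (F : copies G -> R) (A : nat -> seq G) (M : nat -> R) :
  (forall x, 0 <= F x) ->
  (forall k x, x \notin A k -> F (k, x) = 0) ->
  (forall k x, F (k, x) <= M k) ->
  (\int[m]_x (F x)%:E <= \sum_(0 <= k <oo) ((M k) * (size (A k))%:R)%:E)%E.
Proof.
move=> F0 FA FM.
pose X k : set (copies G) := [set x | x.1 = k].
pose Y k : set (copies G) := [set x | x.1 = k /\ x.2 \in A k].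
have -> : [set: copies G] = \bigcup_k X k.
  by apply/seteqP; split => // -[k x] _; exists k.
rewrite ge0_integral_bigcup//=; first last.
- by move=> i j _ _ [[k x] []]; rewrite /X/= => -> ->.
- by move=> x _; rewrite lee_fin.
apply: lee_nneseries => [k _ _|k _]; first by apply: integral_ge0 => x _; rewrite lee_fin.
(* On copy [k] the integrand vanishes off [A k], which leaves a set of mass at most [size (A k)]. *)
have -> : (\int[m]_(x in X k) (F x)%:E = \int[m]_(x in Y k) (F x)%:E)%E.
  rewrite integral_mkcond [RHS]integral_mkcond; apply: eq_integral => -[i x] _.
  rewrite /patch; case: ifPn => [/set_mem|nX].
    rewrite /X/= => ->; case: ifPn => // /negP nY.
    rewrite FA//; apply/negP => xA; apply: nY; apply/mem_set; by split.
  case: ifPn => // /set_mem[/= ik _]; case/negP: nX; exact: mem_set.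
have Ms : (M k * (size (A k))%:R)%:E = ((M k)%:E * (size (A k))%:R%:E)%E by [].
rewrite Ms; apply: (@le_trans _ _ (\int[m]_(x in Y k) (cst (M k)%:E) x)%E).
  by apply: ge0_le_integral => //= -[i x] [/= -> _]; rewrite lee_fin ?FM//
     (le_trans (F0 (k, x)))// FM.
have M0 : 0 <= M k by rewrite (le_trans (F0 (k, 1%g)))// FM.
rewrite integral_cst//; apply: lee_wpmul2l; first by rewrite lee_fin.
rewrite -(size_map (fun x => (k, x) : copies G)).
apply: counting_le_size => -[i x] [/= -> xA]; exact: map_f.
Qed.

Lemma integral_copies_ge (F : copies G -> R) (k : nat) (e : seq G) (M : R) :
  (forall x, 0 <= F x) -> 0 <= M -> uniq e ->
  (forall x, x \in e -> M <= F (k, x)) ->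
  ((M * (size e)%:R)%:E <= \int[m]_x (F x)%:E)%E.
Proof.
move=> F0 M0 ue FM.
pose Y : set (copies G) := [set x | x.1 = k /\ x.2 \in e].
apply: (@le_trans _ _ (\int[m]_(x in Y) (F x)%:E)%E); last first.
  by apply: ge0_subset_integral => // x _; rewrite lee_fin.
apply: (@le_trans _ _ (\int[m]_(x in Y) (cst M%:E) x)%E); last first.
  by apply: ge0_le_integral => //= -[i x] [/= -> xe]; rewrite lee_fin// FM.
rewrite integral_cst// EFinM; apply: lee_wpmul2l; first by rewrite lee_fin.
rewrite -(size_map (fun x => (k, x) : copies G)).
apply: size_le_counting; first by rewrite map_inj_uniq// => x y [].
by move=> _ /mapP[x xe ->]; split.
Qed.

End RegularRep.

(** * Chains of sets and the compression of the associated cocycle *)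

Section WordBalls.
Variable G : groupType.
Implicit Types (S : set G) (g : G).

Definition word_ball S (n : nat) : set G :=
  [set g | exists2 l, (l <= n)%N & set_pow S l g].

Lemma word_length_notin_ball (R : realType) S (n : nat) (t : R) g :
  n%:R < t -> (t%:E <= word_length R S g)%E -> ~ word_ball S n g.
Proof.
move=> nt tg [l ln lg]; move: tg; apply/negP; rewrite -ltNge.
apply: (@le_lt_trans _ _ (n%:R)%:E); last by rewrite lte_fin.
apply: ereal_inf_le; exists (l%:R)%:E; first by exists l.
by rewrite lee_fin ler_nat.
Qed.

(** The lists [e] and [A] bound the cardinality of [E 0] from below and that of [E L] from above;
    the last clause bounds the diameter of [E L] in the left-invariant word metric. *)
Definition folner_chain S (L C r : nat) (E : nat -> set G) (e A : seq G) : Prop :=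
  [/\ uniq e /\ (0 < size e)%N,
      [set` e] `<=` E 0%N /\ E L `<=` [set` A],
      (size A <= C * size e)%N,
      (forall j, (j < L)%N -> E j `<=` E j.+1) /\
        (forall j x s, (j < L)%N -> E j x -> S s -> E j.+1 (x * s)%g)
    & forall x g, E L x -> E L (x * g)%g -> word_ball S r g].

Definition bump (E : nat -> set G) (L : nat) (x : G) : nat :=
  \sum_(j < L) (x \in E j).

End WordBalls.

(** * Tent functions of a chain *)

Section Bump.
Variables (G : groupType) (S : set G) (L C r : nat).
Variables (E : nat -> set G) (e A : seq G).
Hypothesis Ssym : forall s, S s -> S s^-1%g.
Hypothesis chain : folner_chain S L C r E e A.

Let E_le j k : (j <= k <= L)%N -> E j `<=` E k.
Proof.
case: chain => _ _ _ [Emon _] _.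
elim: k => [|k IH] /andP[jk kL].
  by move: jk; rewrite leqn0 => /eqP ->.
move: jk; rewrite leq_eqVlt => /predU1P[->//|jk] x.
by move=> /(IH _ _)/Emon; apply => //; rewrite -ltnS jk ltnW.
Qed.

(** If [x] is in [E j] then [x * s] is in [E j.+1]: the sum for [x] is compared with the sum for
    [x * s] shifted by one index, and only the top term, at most 1, is lost. *)
Let bump_step x s : S s -> (bump E L x <= (bump E L (x * s)%g).+1)%N.
Proof.
case: chain => _ _ _ [_ Es] _ Ss; rewrite /bump.
case: (L) Es => [|l] Es; first by rewrite !big_ord0.
rewrite big_ord_recr [in leqRHS]big_ord_recl /= -[leqRHS]addn1.
rewrite leq_add ?leq_b1//; apply: (leq_trans _ (leq_addl _ _)).
apply: leq_sum => j _; case: (boolP (x \in E j)) => //= /set_mem xE.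
by rewrite lt0b; apply/mem_set; apply: Es => //; rewrite ltnS ltnW.
Qed.

Lemma bump_dist (R : realType) x s : S s ->
  `|(bump E L (x * s)%g)%:R - (bump E L x)%:R| <= 1 :> R.
Proof.
move=> Ss; have := bump_step x Ss; have := bump_step (x * s)%g (Ssym Ss); rewrite mulgK.
rewrite -!(ler_nat R) -!natr1 ler_norml => h1 h2.
by apply/andP; split; lra.
Qed.

Lemma bump_off x : ~ E L x -> bump E L x = 0%N.
Proof.
move=> nE; rewrite /bump big1// => j _; apply/eqP; rewrite eqb0; apply/negP.
by move=> /set_mem; apply: contra_not nE; apply: E_le; rewrite leqnn ltnW.
Qed.

Lemma bump_full x : E 0%N x -> bump E L x = L.
Proof.
move=> E0; rewrite /bump (eq_bigr (fun=> 1%N)) ?sum_nat_const ?card_ord ?muln1//.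
by move=> j _; rewrite mem_set//; apply: E_le E0; rewrite leq0n ltnW.
Qed.

(** The division by the square root of [size e] makes the estimates independent of cardinalities:
    the first sums to at most [C] over [A], the third to [L ^ 2] over [e]. *)
Lemma normalized_bump (R : realType) : exists u : G -> R,
  [/\ forall s x, S s -> (u (x * s)%g - u x) ^+ 2 <= (size e)%:R^-1,
      forall s x, S s -> x \notin A -> u (x * s)%g = u x
    & forall x g, ~ word_ball S r g -> x \in e ->
        (u (x * g)%g - u x) ^+ 2 = L%:R ^+ 2 / (size e)%:R].
Proof.
case: (chain) => -[_ e0] [eE EA] _ [Emon Es] Er.
have e0R : 0 < (size e)%:R :> R by rewrite ltr0n.
exists (fun x => (bump E L x)%:R / Num.sqrt (size e)%:R).
have dE x y : ((bump E L y)%:R / Num.sqrt (size e)%:R -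
   (bump E L x)%:R / Num.sqrt (size e)%:R) ^+ 2 =
   ((bump E L y)%:R - (bump E L x)%:R) ^+ 2 / (size e)%:R :> R.
  by rewrite -mulrBl expr_div_n sqr_sqrtr// ltW.
split => [s x Ss|s x Ss xA|x g ng xe].
- rewrite dE -[leRHS]mul1r ler_pM2r ?invr_gt0// -(real_normK (num_real _)).
  by rewrite expr_le1// bump_dist.
- have nEx : ~ E L x by move=> /EA; apply/negP.
  rewrite (bump_off nEx) /bump big1// => j _; apply/eqP; rewrite eqb0.
  (* If [x * s] were in [E j], the inverse generator would bring [x] back into [E j.+1], hence into
     [E L]. *)
  apply/negP => /set_mem /(Es _ _ _ (ltn_ord j))/(_ (Ssym Ss)); rewrite mulgK.
  by apply: contra_not nEx; apply: E_le; rewrite leqnn ltn_ord.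
- have Ex : E L x by apply: (@E_le 0%N); rewrite ?leqnn//; exact: eE.
  rewrite dE (bump_full (eE _ xe)) bump_off ?sub0r ?sqrrN//.
  by move=> /(Er _ _ Ex).
Qed.

End Bump.

(** Absorbs the logarithmic factor of the radii into a geometric growth as slow as desired. The
    induction works because [M * (z - 1) >= 1]. *)
Lemma succ_le_geometric (R : realType) (z : R) : 1 < z ->
  exists2 M : R, 0 < M & forall k : nat, k.+2%:R <= M * z ^+ k.
Proof.
move=> z1; exists (2 + (z - 1)^-1).
  by rewrite addr_gt0 ?invr_gt0 ?subr_gt0.
have M2 : 0 < (z - 1)^-1 by rewrite invr_gt0 subr_gt0.
elim=> [|k IH]; first by rewrite mulr1; lra.
have zk : 1 <= z ^+ k by rewrite exprn_ege1// ltW.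
have h : 1 <= (2 + (z - 1)^-1) * (z - 1).
  have zV : (z - 1)^-1 * (z - 1) = 1 by rewrite mulVf// gt_eqF// subr_gt0.
  by rewrite mulrDl zV; lra.
rewrite -natr1 exprS; nra.
Qed.

Lemma geometric_eseries_lty (R : realType) (c z : R) : 0 <= c -> 0 < z -> z < 1 ->
  (\sum_(0 <= k <oo) (c * z ^+ k)%:E < +oo)%E.
Proof.
move=> c0 z0 z1; apply: (@le_lt_trans _ _ (c / (1 - z))%:E); last exact: ltry.
apply: lime_le.
  by apply: is_cvg_nneseries => n _ _; rewrite lee_fin mulr_ge0// exprn_ge0// ltW.
apply: nearW => n; rewrite sumEFin lee_fin.
have := @geometric_le_lim R n c z c0 z0; rewrite ger0_norm ?(ltW z0)//; exact.
Qed.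

(** Passes from estimates at the radii [r k] to all large [t]: the index sought precedes the first
    radius that reaches [t]. *)
Lemma first_crossing (R : realType) (r : nat -> nat) (t : R) :
  (forall k, (k <= r k)%N) -> (r 0%N)%:R < t ->
  exists k, (r k)%:R < t <= (r k.+1)%:R.
Proof.
move=> rk r0t.
have ex : exists k, t <= (r k)%:R.
  have t0 : 0 <= t by apply: (le_trans _ (ltW r0t)).
  exists (Num.bound t); apply: (le_trans (ltW (archi_boundP t0))).
  by rewrite ler_nat rk.
case: (ex_minnP ex) => -[|k] tk kmin; first by move: tk; rewrite leNgt r0t.
exists k; rewrite tk andbT ltNge; apply/negP => /kmin; by rewrite ltnn.
Qed.

(** * From chains at all scales to a compression rate *)

Section RateFromChains.
Variables (R : realType) (G : groupType) (S : set G) (C D : nat).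
Hypothesis hS : finite_symmetric_generating S.
Hypotheses (C0 : (0 < C)%N) (D0 : (0 < D)%N).
Let r k := (C * 2 ^ (k * D) * k.+1)%N.
Hypothesis chains : forall k, exists E e A, folner_chain S (2 ^ k) C (r k) E e A.
Local Notation m := (counting : {measure set (copies G) -> \bar R}).

(** Copy [k] carries the normalized tent function of scale [2 ^ k], weighted by [z ^- k]. On a
    generator the squared norm is at most the sum of the [C * z ^- (2 * k)]; outside the ball of
    radius [r k], copy [k] alone contributes [(2 / z) ^ (2 * k)]. *)
Lemma geometric_cocycle (z : R) : 1 < z ->
  exists2 b : G -> L2 m, cocycle (regular_rep R G) b &
    forall k g, ~ word_ball S (r k) g -> (((2 / z) ^+ k)%:E <= L2_norm (b g))%E.
Proof.
move=> z1; have z0 : 0 < z by lra.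
have [_ Ssym gS] := hS.
have bumps k : exists u : (G -> R) * seq G * seq G,
  [/\ uniq u.1.2, (0 < size u.1.2)%N /\ (size u.2 <= C * size u.1.2)%N,
      forall s x, S s -> (u.1.1 (x * s)%g - u.1.1 x) ^+ 2 <= (size u.1.2)%:R^-1,
      forall s x, S s -> x \notin u.2 -> u.1.1 (x * s)%g = u.1.1 x
    & forall x g, ~ word_ball S (r k) g -> x \in u.1.2 ->
        (u.1.1 (x * g)%g - u.1.1 x) ^+ 2 = (2 ^ k)%:R ^+ 2 / (size u.1.2)%:R].
  have [E [e [A ch]]] := chains k.
  have [u [h1 h2 h3]] := normalized_bump Ssym ch R.
  by exists (u, e, A); split => //; case: ch => -[].
have {bumps} [U hU] := choice bumps.
pose u (x : copies G) : R := z ^- x.1 * (U x.1).1.1 x.2.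
have cuE g k x : coboundary u g (k, x) =
    z ^- k * ((U k).1.1 (x * g)%g - (U k).1.1 x).
  by rewrite /coboundary !fctE/= /u/= mulrBr.
have mem s : S s -> coboundary u s \in Lfun m 2%:E.
  move=> Ss; apply: L2_memE.
  apply: (@le_lt_trans _ _ (\sum_(0 <= k <oo) (C%:R * (z ^- 2) ^+ k)%:E)%E); last first.
    apply: geometric_eseries_lty; rewrite ?invr_gt0 ?exprn_gt0//.
    by rewrite invf_lt1 ?exprn_gt0 ?exprn_egt1.
  apply: (le_trans (integral_copies_le (A := fun k => (U k).2)
      (M := fun k => z ^- k ^+ 2 * (size (U k).1.2)%:R^-1) _ _ _)).
  - by move=> x; exact: sqr_ge0.
  - move=> k x xA; have [_ _ _ h _] := hU k.
    by rewrite cuE h// subrr mulr0 expr0n.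
  - move=> k x; have [_ _ h _ _] := hU k.
    by rewrite cuE exprMn ler_wpM2l ?sqr_ge0 ?h.
  apply: lee_nneseries => [k _ _|k _].
    by rewrite lee_fin mulr_ge0// mulr_ge0 ?sqr_ge0// invr_ge0.
  have [_ [h1 h2] _ _ _] := hU k.
  have zkE : z ^- k ^+ 2 = (z ^- 2) ^+ k by rewrite -!exprVn -!exprM mulnC.
  rewrite lee_fin zkE -mulrA [leRHS]mulrC ler_wpM2l//.
    by rewrite exprn_ge0// invr_ge0 sqr_ge0.
  rewrite mulrC.
  by rewrite ler_pdivrMr ?ltr0n// -natrM ler_nat.
have hb := coboundary_mem gS mem.
exists (fun g => L2_of (hb g)); first exact: coboundary_cocycle.
move=> k g ng; have [ue [e0 _] _ _ h] := hU k.
rewrite /L2_norm L2_normE.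
have -> : ((2 / z) ^+ k)%:E = ((((2 / z) ^+ k) ^+ 2)%:E `^ 2^-1)%E.
  rewrite poweR_EFin powR12_sqrt ?sqr_ge0// sqrtr_sqr.
  by rewrite ger0_norm// exprn_ge0// divr_ge0// ltW.
have I0 : (0 <= \int[m]_x (coboundary u g x ^+ 2)%:E)%E.
  by apply: integral_ge0 => x _; rewrite lee_fin sqr_ge0.
apply: gt0_ler_poweR; first by rewrite invr_ge0.
- by rewrite in_itv/= lee_fin sqr_ge0 leey.
- by rewrite in_itv/= I0 leey.
have := @integral_copies_ge R G (fun x => coboundary u g x ^+ 2) k (U k).1.2
   (((2 / z) ^+ k) ^+ 2 / (size (U k).1.2)%:R).
rewrite mulfVK ?pnatr_eq0 -?lt0n//; apply => // [x||x xe].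
- exact: sqr_ge0.
- by rewrite divr_ge0 ?sqr_ge0.
- rewrite cuE [leRHS]exprMn h// natrX expr_div_n.
  by rewrite expr_div_n mulrA exprVn [_ * 2 ^+ k ^+ 2]mulrC.
Qed.

Lemma rate_from_chains : ((1 / D%:R)%:E <= Hilbert_compression_rate R S)%E.
Proof.
have D0R : 0 < D%:R :> R by rewrite ltr0n.
(* The bound is reached through exponents [a] strictly below it; the maximum below keeps [a]
   positive when [eps] is large. *)
suff main a : 0 < a -> a < 1 / D%:R -> (a%:E <= Hilbert_compression_rate R S)%E.
  apply/lee_addgt0Pr => eps eps0.
  have d0 : 0 < 1 / D%:R :> R by rewrite divr_gt0.
  rewrite -leeBlDr//; apply: le_trans (main (Num.max (1 / D%:R / 2) (1 / D%:R - eps)) _ _).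
  - by rewrite -EFinB lee_fin le_max lexx orbT.
  - by rewrite lt_max divr_gt0.
  - by rewrite gt_max; apply/andP; split; lra.
move=> a0 aD.
(* Here [y = 2 ^ (a * D) < 2], and [z] splits the gap evenly: [2 / z = y * z]. One factor [z] pays
   for summability, the other absorbs the factor [k.+2]. *)
pose q : R := 2 `^ a; pose y := q ^+ D; pose z := Num.sqrt (2 / y).
have q0 : 0 < q by apply: powR_gt0.
have y0 : 0 < y by rewrite exprn_gt0.
have y2 : y < 2.
  rewrite /y /q -powR_mulrn ?powR_ge0// -powRrM -[ltRHS]powRr1//.
  rewrite /powR !gt_eqF// ltr_expR ltr_pM2r ?ln_gt0 ?ltr1n//.
  by rewrite -ltr_pdivlMr.
have z2 : z ^+ 2 = 2 / y by rewrite sqr_sqrtr// divr_ge0// ltW.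
have z1 : 1 < z by rewrite -sqrtr1 ltr_sqrt ?divr_gt0// ltr_pdivlMr// mul1r.
have z0 : 0 < z by lra.
have yzE : 2 / z = y * z.
  apply: (mulIf (lt0r_neq0 z0)); rewrite mulfVK ?lt0r_neq0// -mulrA -expr2 z2.
  by field; exact: lt0r_neq0.
have [b cb hb] := geometric_cocycle z1.
have [M M0 hM] := succ_le_geometric z1.
apply: (le_trans _ (ereal_sup_ubound _)); last first.
  by exists default_measure_display, (copies G), m, (regular_rep R G).
apply: ereal_sup_ubound; exists a => //; exists b; split => //.
exists 1 => //; exists (C%:R `^ a * y * M).
  by rewrite !mulr_gt0 ?powR_gt0 ?ltr0n.
near=> t.
have tr0 : (r 0%N)%:R < t by near: t; exact: nbhs_pinfty_gt.
have rk k : (k <= r k)%N.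
  by rewrite /r -[leqLHS]mul1n leq_mul// muln_gt0 C0 expn_gt0.
have [k /andP[rkt trk]] := first_crossing rk tr0.
have t0 : 0 <= t by rewrite (le_trans _ (ltW rkt)).
rewrite mul1r.
apply: (@le_trans _ _ ((C%:R `^ a * y * M)%:E * ((y * z) ^+ k)%:E)%E); last first.
  apply: lee_wpmul2l; first by rewrite lee_fin !mulr_ge0 ?powR_ge0// ltW.
  apply: le_ereal_inf_tmp => _ [g /= tg <-]; rewrite -yzE; apply: hb.
  exact: word_length_notin_ball rkt tg.
rewrite -EFinM lee_fin.
(* The power of [r k.+1] is [C ^ a * y ^ k.+1 * k.+2 ^ a], and [k.+2 ^ a <= k.+2 <= M * z ^ k] since
   [a <= 1]. *)
apply: (@le_trans _ _ ((r k.+1)%:R `^ a)).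
  by apply: ge0_ler_powR; rewrite ?nnegrE// ltW.
have a1 : a <= 1.
  by rewrite (le_trans (ltW aD))// ler_pdivrMr// mul1r ler1n.
have qE n : (2 ^ n)%:R `^ a = q ^+ n.
  by rewrite natrX -powR_mulrn// -powRrM mulrC powRrM powR_mulrn// ltW.
have -> : (r k.+1)%:R `^ a = C%:R `^ a * y * y ^+ k * k.+2%:R `^ a.
  by rewrite /r !natrM !powRM// qE mulnC exprM -/y exprS mulrA.
rewrite -!mulrA 2?ler_pM2l ?powR_gt0 ?ltr0n// exprMn [leRHS]mulrCA.
rewrite ler_pM2l ?exprn_gt0//; apply: le_trans (hM k).
by rewrite ler1_powR// ler1n.
Unshelve. all: by end_near. Qed.
End RateFromChains.

(** * Construction of chains in abelian-by-abelian groups *)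

Section WordBallTheory.
Variables (G : groupType) (S : set G).
Hypothesis hS : finite_symmetric_generating S.
Implicit Types (g h : G).

Lemma word_ball_mono m n g : (m <= n)%N -> word_ball S m g -> word_ball S n g.
Proof. by move=> mn [l lm lg]; exists l => //; exact: leq_trans lm mn. Qed.

Lemma word_ball1 n : word_ball S n 1%g.
Proof. by exists 0%N. Qed.

Lemma word_ball_gen s : S s -> word_ball S 1 s.
Proof. by move=> Ss; exists 1%N => //=; exists s => //; exists 1%g => //; rewrite mulg1. Qed.

Lemma set_powM m n g h : set_pow S m g -> set_pow S n h -> set_pow S (m + n) (g * h)%g.
Proof.
elim: m g => [|m IH] g /=; first by move=> ->; rewrite mul1g.
move=> [s Ss [x xm <-]] hn; exists s => //; exists (x * h)%g; first exact: IH.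
by rewrite mulgA.
Qed.

Lemma set_powV n g : set_pow S n g -> set_pow S n g^-1%g.
Proof.
have [_ Sinv _] := hS.
elim: n g => [|n IH] g; first by move=> /= ->; rewrite invg1.
move=> [s Ss [x /IH xn <-]]; rewrite invgM -addn1.
apply: set_powM => //=; exists s^-1%g; first exact: Sinv.
by exists 1%g => //; rewrite mulg1.
Qed.

Lemma word_ballM m n g h :
  word_ball S m g -> word_ball S n h -> word_ball S (m + n) (g * h)%g.
Proof.
move=> [l lm lg] [l' ln lh]; exists (l + l')%N; first exact: leq_add.
exact: set_powM.
Qed.

Lemma word_ballV n g : word_ball S n g -> word_ball S n g^-1%g.
Proof. by move=> [l lm lg]; exists l => //; exact: set_powV. Qed.

Lemma word_ball_exhausts g : exists n, word_ball S n g.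
Proof.
have [_ _ gS] := hS; have : generated S g by rewrite gS.
move=> /(_ [set g | exists n, word_ball S n g]); apply; split => [|s Ss /=].
  split => /= [|x y [m mx] [n ny]|x [n nx]].
  - by exists 0%N; exact: word_ball1.
  - by exists (m + n)%N; exact: word_ballM.
  - by exists n; exact: word_ballV.
by exists 1%N; exact: word_ball_gen.
Qed.

End WordBallTheory.

(** * Boxes in the abelian quotient *)

Section Boxes.
Variables (N : zmodType) (d : nat) (t : 'I_d -> N) (T : seq N).

(* Coordinates in 'I_(2 * c).+1 are shifted by [c] to range over [-c, c]. *)
Definition box (c : nat) : seq N :=
  undup [seq x + \sum_i t i *~ (((v : {ffun 'I_d -> 'I_(2 * c).+1}) i)%:Z - c%:Z)
        | x <- T, v <- enum {ffun 'I_d -> 'I_(2 * c).+1}].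

Lemma boxP c n : reflect (exists2 x, x \in T & exists2 v : 'I_d -> int,
    (forall i, `|v i| <= c%:Z) & n = x + \sum_i t i *~ v i) (n \in box c).
Proof.
rewrite mem_undup; apply: (iffP allpairsP) => [[[x v] /= [xT _ ->]]|[x xT [v vc ->]]].
  exists x => //; exists (fun i => (v i)%:Z - c%:Z) => // i.
  by have := ltn_ord (v i); lia.
have vi i : (`|(v i + c%:Z)%R| < (2 * c).+1)%N by have := vc i; lia.
exists (x, [ffun i => Ordinal (vi i)]); split => //=; first by rewrite mem_enum.
congr (_ + _); apply: eq_bigr => i _; rewrite ffunE/=; congr (_ *~ _).
by have := vc i; lia.
Qed.

Lemma box_mono c c' : (c <= c')%N -> {subset box c <= box c'}.
Proof.
move=> cc' n /boxP[x xT [v vc ->]]; apply/boxP; exists x => //; exists v => // i.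
by have := vc i; lia.
Qed.

Lemma size_box c : (size (box c) <= size T * (2 * c).+1 ^ d)%N.
Proof.
apply: (leq_trans (size_undup _)); rewrite size_allpairs -cardE.
by rewrite card_ffun !card_ord.
Qed.

(** A coordinate in [[-2c, 2c]] is one in [[-c, c]] shifted by [-c], [0] or [c], so [3 ^ d]
    translates of the small box cover the large one, even when coordinates are not unique. *)
Lemma size_box_double c : (size (box (2 * c)) <= size (box c) * 3 ^ d)%N.
Proof.
pose w := [seq x + \sum_i t i *~ (c%:Z * (((v : {ffun 'I_d -> 'I_3}) i)%:Z - 1))
        | x <- box c, v <- enum {ffun 'I_d -> 'I_3}].
have -> : (size (box c) * 3 ^ d)%N = size w.
  by rewrite size_allpairs -cardE card_ffun !card_ord.
apply: uniq_leq_size; first exact: undup_uniq.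
move=> _ /boxP[x xT [v vc ->]].
(* The digits 0, 1, 2 encode the shifts [-c], [0], [c]. *)
pose a i : 'I_3 := if v i < - c%:Z then inord 0 else if c%:Z < v i then inord 2 else inord 1.
pose b i : int := c%:Z * ((a i)%:Z - 1).
have bE i : b i = if v i < - c%:Z then - c%:Z else if c%:Z < v i then c%:Z else 0.
  rewrite /b /a; case: ifP => _; first by rewrite inordK//; lia.
  by case: ifP => _; rewrite inordK//; lia.
apply/allpairsP; exists (x + \sum_i t i *~ (v i - b i), [ffun i => a i]); split => /=.
- apply/boxP; exists x => //; exists (fun i => v i - b i) => // i.
  by have := vc i; rewrite bE; case: ifP; last case: ifP; lia.
- by rewrite mem_enum.
- rewrite -addrA -big_split; congr (_ + _); apply: eq_bigr => i _ /=.
  by rewrite ffunE -mulrzDr subrK.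
Qed.

Hypothesis span : forall n, exists2 x, x \in T & exists v : 'I_d -> int,
  n = x + \sum_i t i *~ v i.

Lemma box_exhausts (l : seq N) : exists c, {subset l <= box c}.
Proof.
elim: l => [|n l [c lc]]; first by exists 0%N.
have [x xT [v ->]] := span n.
exists (maxn c (\sum_i `|v i|)%N) => y; rewrite inE => /predU1P[->|/lc]; last first.
  by apply: box_mono; rewrite leq_maxl.
apply/boxP; exists x => //; exists v => // i.
have : (`|v i| <= \sum_i `|v i|)%N by rewrite (bigD1 i)//= leq_addr.
by lia.
Qed.

Lemma box_neq0 c : (0 < size (box c))%N.
Proof.
have [x xT _] := span 0.
have : x \in box c.
  apply/boxP; exists x => //; exists (fun=> 0) => [i|]; first by rewrite normr0.
  by rewrite big1 ?addr0// => i _; rewrite mulr0z.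
by case: (box c).
Qed.

(** The sum of [y] and the finite part is rewritten as a new element of [T] plus coordinates at most
    [c], which add to the old ones. *)
Lemma box_add m c n y : (forall x, x \in T -> x + y \in box c) ->
  n \in box m -> n + y \in box (m + c).
Proof.
move=> yc /boxP[x xT [v vm ->]].
have /boxP[x' xT' [v' vc' xyE]] := yc x xT.
apply/boxP; exists x' => //; exists (fun i => v i + v' i) => [i|].
  by have := vm i; have := vc' i; lia.
rewrite addrAC xyE -addrA -big_split; congr (_ + _); apply: eq_bigr => i _ /=.
by rewrite -mulrzDr addrC.
Qed.

End Boxes.

(** * Polynomial growth of products of commuting elements *)

Section BoundedProducts.
Variables (G : groupType) (H : set G) (xs : seq G).
Hypothesis Hsub : is_subgroup H.
Hypothesis Hcomm : forall x y, H x -> H y -> commute x y.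
Hypothesis xsH : forall x, x \in xs -> H x.

Fixpoint products (ys : seq G) (n : nat) : seq G :=
  if n is n'.+1 then
    undup (products ys n' ++ [seq (x * g)%g | x <- ys, g <- products ys n'])
  else [:: 1%g].

Lemma products_uniq n : uniq (products xs n).
Proof. by case: n => //= n; exact: undup_uniq. Qed.

Lemma products_mono m n : (m <= n)%N -> {subset products xs m <= products xs n}.
Proof.
elim: n => [|n IH]; first by rewrite leqn0 => /eqP ->.
rewrite leq_eqVlt => /predU1P[->//|/IH h] g /h gn.
by rewrite /= mem_undup mem_cat gn.
Qed.

Lemma products_step n x g : x \in xs -> g \in products xs n ->
  (x * g)%g \in products xs n.+1.
Proof.
move=> xx gn; rewrite /= mem_undup mem_cat; apply/orP; right.
by apply/allpairsP; exists (x, g).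
Qed.

Lemma products_ind (P : nat -> G -> Prop) :
  P 0%N 1%g -> (forall n g, P n g -> P n.+1 g) ->
  (forall n x g, x \in xs -> P n g -> P n.+1 (x * g)%g) ->
  forall n g, g \in products xs n -> P n g.
Proof.
move=> P0 PS PM; elim=> [|n IH] g /=; first by rewrite inE => /eqP ->.
rewrite mem_undup mem_cat => /orP[/IH/PS//|/allpairsP[[x y] /= [xx /IH yn ->]]].
exact: PM.
Qed.

Lemma products_sub n g : g \in products xs n -> H g.
Proof.
have [H1 HM _] := Hsub.
move: n g; apply: products_ind => // n x g xx Hg.
by apply: HM => //; exact: xsH.
Qed.

Lemma products_ball (S : set G) (b : nat) n g :
  (forall x, x \in xs -> word_ball S b x) ->
  g \in products xs n -> word_ball S (n * b) g.
Proof.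
move=> xb; move: n g; apply: products_ind => [|n g|n x g xx gn].
- exact: word_ball1.
- by apply: word_ball_mono; rewrite mulSn leq_addl.
- by rewrite mulSn; apply: word_ballM => //; exact: xb.
Qed.

Definition expmul (y : G) (a : nat) (g : G) : G := (y ^+ a * g)%g.

(** Normal forms with every exponent at most [n]; repetitions are kept, so that the length is
    exactly a power. *)
Fixpoint monomials (ys : seq G) (n : nat) : seq G :=
  if ys is y :: ys' then
    [seq expmul y a g | a <- iota 0 n.+1, g <- monomials ys' n]
  else [:: 1%g].

Lemma monomials_cons y ys n : monomials (y :: ys) n =
  [seq expmul y a g | a <- iota 0 n.+1, g <- monomials ys n].
Proof. by []. Qed.

Lemma monomials_consP y ys n g :
  reflect (exists a h, [/\ (a <= n)%N, h \in monomials ys n & g = (y ^+ a * h)%g])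
          (g \in monomials (y :: ys) n).
Proof.
rewrite monomials_cons.
apply: (iffP (@allpairsP nat G G (expmul y) _ _ g)) => [[[a h] []]|[a [h []]]].
  by rewrite mem_iota => an /= hn ->; exists a, h.
by move=> an hn ->; exists (a, h); rewrite mem_iota.
Qed.

Lemma size_monomials ys n : size (monomials ys n) = (n.+1 ^ size ys)%N.
Proof.
elim: ys => [|y ys IH]; first by rewrite expn0.
by rewrite monomials_cons size_allpairs IH size_iota expnS.
Qed.

Lemma monomials_mono ys n : {subset monomials ys n <= monomials ys n.+1}.
Proof.
elim: ys => [|y ys IH]// g /monomials_consP[a [h [an /IH hn ->]]].
by apply/monomials_consP; exists a, h; split => //; exact: leqW.
Qed.

(** Commutativity carries [x] to the slot of its own power, whose exponent rises by one. *)
Lemma monomials_step ys n x g : {subset ys <= xs} -> x \in ys ->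
  g \in monomials ys n -> (x * g)%g \in monomials ys n.+1.
Proof.
elim: ys g => [|y ys IH] g// yx.
have ysx : {subset ys <= xs} by move=> z zy; apply: yx; rewrite inE zy orbT.
have yxs : y \in xs by apply: yx; rewrite inE eqxx.
move=> xys /monomials_consP[a [h [an hn ->]]]; apply/monomials_consP.
move: xys; rewrite inE => /predU1P[->|xy].
  exists a.+1, h; split => //; last by rewrite expgS mulgA.
  exact: monomials_mono.
exists a, (x * h)%g; split; [exact: leqW|exact: IH|].
have cxy : commute x (y ^+ a)%g.
  by apply: commuteX; apply: Hcomm; apply: xsH => //; exact: ysx.
by rewrite mulgA cxy mulgA.
Qed.

Lemma size_products n : (size (products xs n) <= n.+1 ^ size xs)%N.
Proof.
rewrite -(size_monomials xs n); apply: uniq_leq_size; first exact: products_uniq.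
move: n; apply: products_ind => [|n g|n x g xx].
- elim: (xs) => [|y ys IH]; first by rewrite inE.
  by apply/monomials_consP; exists 0%N, 1%g; rewrite expg0 mulg1.
- exact: monomials_mono.
- exact: monomials_step.
Qed.

End BoundedProducts.

(** Otherwise [f] would more than double at each of the [n] steps and reach [2 ^ n]. *)
Lemma pigeonhole_doubling (f : nat -> nat) (n : nat) :
  (0 < f 0)%N -> (f n < 2 ^ n)%N -> exists2 i, (i < n)%N & (f i.+1 <= 2 * f i)%N.
Proof.
move=> f0 fn; apply: contrapT => no.
have : (2 ^ n <= f n)%N; last by rewrite leqNgt fn.
have : forall i, (i <= n)%N -> (2 ^ i <= f i)%N; last exact.
elim=> [|i IH] ik //; rewrite expnS.
apply: (leq_trans (n := 2 * f i)); first by rewrite leq_mul2l IH ?orbT// ltnW.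
rewrite leqNgt; apply/negP => /ltnW h; apply: no; by exists i.
Qed.

Lemma exponential_dominates (Q c : nat) : exists z, (Q * (z + c) < 2 ^ z)%N.
Proof.
(* With this [w], [Q * (2 * w + c) <= Q * (3 * w) <= w * w < 2 ^ w * 2 ^ w]. *)
pose w := (3 * Q + c)%N; exists (2 * w)%N.
have ww := ltn_expl w (isT : (1 < 2)%N).
apply: (@leq_ltn_trans (w * w)).
  apply: (@leq_trans (Q * (3 * w))); first by rewrite leq_mul2l; apply/orP; right; lia.
  by rewrite mulnA leq_mul2r; apply/orP; right; lia.
by rewrite mul2n -addnn expnD ltn_mul.
Qed.

(** * Lifts of box elements of controlled length *)

Section Lifts.
Variables (N : zmodType) (G : groupType) (p : G -> N) (S : set G).
Hypothesis pM : forall g h, p (g * h)%g = p g + p h.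
Hypothesis psurj : forall n, exists g, p g = n.
Hypothesis hS : finite_symmetric_generating S.
Variables (d : nat) (t : 'I_d -> N) (T : seq N).

Lemma additive1 : p 1%g = 0.
Proof. by apply: (addrI (p 1%g)); rewrite -pM mulg1 addr0. Qed.

Lemma additiveV g : p g^-1%g = - p g.
Proof. by apply: (addrI (p g)); rewrite -pM mulgV additive1 subrr. Qed.

Definition lifts (l : nat) (n : N) : Prop := exists2 g, p g = n & word_ball S l g.

Lemma lifts0 l : lifts l 0.
Proof. by exists 1%g; [exact: additive1|exact: word_ball1]. Qed.

Lemma liftsD l l' n n' : lifts l n -> lifts l' n' -> lifts (l + l') (n + n').
Proof.
by move=> [g <- gl] [h <- hl]; exists (g * h)%g; [exact: pM|exact: word_ballM].
Qed.

Lemma liftsN l n : lifts l n -> lifts l (- n).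
Proof. by move=> [g <- gl]; exists g^-1%g; [exact: additiveV|exact: word_ballV]. Qed.

Lemma lifts_mono l l' n : (l <= l')%N -> lifts l n -> lifts l' n.
Proof. by move=> ll [g gn gl]; exists g => //; exact: word_ball_mono gl. Qed.

Lemma liftsMz l n (z : int) : lifts l n -> lifts (`|z| * l) (n *~ z).
Proof.
move=> ln; have nat_case k : lifts (k * l) (n *+ k).
  elim: k => [|k IH]; first exact: lifts0.
  by rewrite mulSn mulrS; exact: liftsD.
case: z => k; first by rewrite -pmulrn; exact: nat_case.
by rewrite NegzE mulrNz; apply: liftsN; exact: nat_case.
Qed.

Lemma lifts_exhaust (l : seq N) : exists b, forall n, n \in l -> lifts b n.
Proof.
elim: l => [|n l [b hb]]; first by exists 0%N.
have [g gn] := psurj n; have [c gc] := word_ball_exhausts hS g.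
exists (maxn b c) => y; rewrite inE => /predU1P[->|/hb].
  by apply: (lifts_mono (leq_maxr _ _)); exists g.
by apply: lifts_mono; rewrite leq_maxl.
Qed.

(** The element of [T] and the [d] multiples of the [t i], with coefficients at most [m], are lifted
    separately, so the length is linear in [m]. *)
Lemma lifts_box : exists b, forall m n, n \in box t T m -> lifts (b * m.+1) n.
Proof.
have [b hb] := lifts_exhaust (T ++ codom t).
exists (b * d.+1)%N => m n /boxP[x xT [v vm ->]].
have hT : lifts b x by apply: hb; rewrite mem_cat xT.
have ht i : lifts b (t i) by apply: hb; rewrite mem_cat codom_f orbT.
apply: (@lifts_mono (b + \sum_(i < d) m * b)).
  by rewrite sum_nat_const card_ord; nia.
apply: liftsD => //.
elim/big_ind2 : _ => [|l l' n1 n2|i _]; first exact: lifts0.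
  exact: liftsD.
apply: lifts_mono (liftsMz (v i) (ht i)).
by rewrite leq_mul2r; apply/orP; right; have := vm i; lia.
Qed.

(* A lift of minimal length, so that one section serves boxes of every size. *)
Lemma short_section : exists (s : N -> G) (b : nat),
  (forall n, p (s n) = n) /\
  (forall m n, n \in box t T m -> word_ball S (b * m.+1) (s n)).
Proof.
have short n : exists g, p g = n /\ forall l, lifts l n -> word_ball S l g.
  have ex : exists l, `[< lifts l n >].
    have [g gn] := psurj n; have [c gc] := word_ball_exhausts hS g.
    by exists c; apply/asboolP; exists g.
  case: (ex_minnP ex) => l /asboolP[g gn gl] lmin.
  exists g; split => // l' /asboolP/lmin ll; exact: word_ball_mono gl.
have [s hs] := choice short; have [b hb] := lifts_box.
exists s, b; split => [n|m n /hb]; first by case: (hs n).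
by case: (hs n) => _; apply.
Qed.

End Lifts.

Lemma leq_wexp2r m n e : (m <= n)%N -> (m ^ e <= n ^ e)%N.
Proof. by move=> mn; elim: e => // e IH; rewrite !expnS leq_mul. Qed.

Lemma folner_chain_mono (G : groupType) (S : set G) L C C' r r' E e A :
  (C <= C')%N -> (r <= r')%N ->
  folner_chain S L C r E e A -> folner_chain S L C' r' E e A.
Proof.
move=> CC rr [h1 h2 h3 h4 h5]; split => //.
  by apply: (leq_trans h3); rewrite leq_mul2r CC orbT.
by move=> x g Ex Exg; apply: word_ball_mono rr (h5 _ _ Ex Exg).
Qed.

(** * Construction of the chains *)

Section ChainsExist.
Variables (N : zmodType) (G : groupType) (p : G -> N) (S : set G).
Hypothesis pM : forall g h, p (g * h)%g = p g + p h.
Hypothesis psurj : forall n, exists g, p g = n.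
Hypothesis kerC : forall g h, p g = 0 -> p h = 0 -> commute g h.
Hypothesis hS : finite_symmetric_generating S.
Variables (d : nat) (t : 'I_d -> N) (T : seq N).
Hypothesis span : forall n, exists2 x, x \in T & exists v : 'I_d -> int,
  n = x + \sum_i t i *~ v i.

Let ker_subgroup : is_subgroup [set g | p g = 0].
Proof.
split => /= [|x y xH yH|x xH]; first exact: additive1.
  by rewrite pM xH yH addr0.
by rewrite additiveV// xH oppr0.
Qed.

(** Since [s n * g = schreier n g * s (n + p g)], right multiplication of [h * s n] by a generator
    adds one commuting kernel factor to [h] and moves [n] by [p g]. The last hypothesis is the one
    that the pigeonhole on products requires. *)
Lemma chains_at_scale (s : N -> G) (b c L I : nat) (gens : seq G) :
  (forall n, p (s n) = n) ->
  (forall m n, n \in box t T m -> word_ball S (b * m.+1) (s n)) ->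
  S = [set` gens] ->
  (forall g x, g \in gens -> x \in T -> x + p g \in box t T c) ->
  ((I * L).+1 ^ (size T * (4 * (c * L)).+1 ^ d * size gens) < 2 ^ I)%N ->
  exists E e A,
    folner_chain S L (2 * 3 ^ d)
      (2 * (I * L * (2 * (b * (2 * (c * L)).+1) + 1) + b * (2 * (c * L)).+1)) E e A.
Proof.
move=> ps sball Sgens cgens small.
set B := box t T; set l := (b * _)%N.
pose schreier (n : N) (g : G) : G := (s n * g * (s (n + p g))^-1)%g.
(* For [n] near the edge, [n + p g] may leave the box, where [s] is not controlled; the filter keeps
   only the short Schreier generators, among them all those used by the chain. *)
pose xs := [seq x <- [seq schreier n g | n <- B (2 * (c * L))%N, g <- gens]
               | `[< word_ball S (2 * l + 1) x >]].
have xsb x : x \in xs -> word_ball S (2 * l + 1) x.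
  by rewrite mem_filter => /andP[/asboolP].
have schreierK n g : (s n * g = schreier n g * s (n + p g))%g.
  by rewrite /schreier mulgVK.
have xsH x : x \in xs -> p x = 0.
  rewrite mem_filter => /andP[_ /allpairsP[[n g] /= [_ _ ->]]].
  by rewrite !pM additiveV// !ps subrr.
have size_xs : (size xs <= size T * (4 * (c * L)).+1 ^ d * size gens)%N.
  rewrite size_filter; apply: (leq_trans (count_size _ _)).
  rewrite size_allpairs leq_mul2r; apply/orP; right.
  by apply: (leq_trans (size_box _ _ _)); rewrite mulnA.
pose P := products xs.
have PH n g : g \in P n -> p g = 0 by exact: (products_sub ker_subgroup).
(* Pigeonhole along multiples of [L], because the chain adds up to [L] factors in all. *)
have [i iI Pi] : exists2 i, (i < I)%N &
    (size (P (i.+1 * L)%N) <= 2 * size (P (i * L)%N))%N.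
  apply: (@pigeonhole_doubling (fun i => size (P (i * L)%N))) => //.
  apply: leq_ltn_trans small.
  apply: (leq_trans (size_products kerC xsH _)).
  by rewrite leq_pexp2l.
pose mk (h : G) (n : N) : G := (h * s n)%g.
(* The map [p] recovers [n] from [h * s n], so cardinalities multiply. *)
have mkI h n h' n' : p h = 0 -> p h' = 0 -> mk h n = mk h' n' -> h = h' /\ n = n'.
  move=> hH h'H E; have nn : n = n'.
    by have := congr1 p E; rewrite /mk !pM hH h'H !add0r !ps.
  by split => //; move: E; rewrite /mk nn => /mulIg.
(* Each step allows one more factor and widens the box by [c]; starting from side [c * L] the box
   only doubles, at a cost of [3 ^ d]. *)
exists (fun j => [set g | exists h n,
  [/\ h \in P (i * L + j)%N, n \in B (c * (L + j))%N & g = mk h n]]).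
exists [seq mk h n | h <- P (i * L)%N, n <- B (c * L)%N].
exists [seq mk h n | h <- P (i * L + L)%N, n <- B (2 * (c * L))%N].
have P0 m : (0 < size (P m))%N.
  have : 1%g \in P m by apply: (products_mono (leq0n m)); rewrite inE.
  by case: (P m).
have Bball n : n \in B (2 * (c * L))%N -> word_ball S l (s n) by exact: sball.
have BL j n : (j <= L)%N -> n \in B (c * (L + j))%N -> n \in B (2 * (c * L))%N.
  by move=> jL; apply: box_mono; nia.
split.
- split; last by rewrite size_allpairs muln_gt0 P0 (box_neq0 span).
  apply: allpairs_uniq; [exact: products_uniq|exact: undup_uniq|].
  move=> [h n] [h' n'] /allpairsP[[a b'] /= [aP _ [-> ->]]].
  move=> /allpairsP[[a' b''] /= [a'P _ [-> ->]]] E.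
  by have [-> ->] := mkI _ _ _ _ (PH _ _ aP) (PH _ _ a'P) E.
- split => [g|g] /=.
    move=> /allpairsP[[h n] /= [hP nB ->]]; exists h, n.
    by rewrite !addn0.
  move=> [h [n [hP nB ->]]]; apply/allpairsP; exists (h, n); split => //=.
  exact: BL nB.
- rewrite !size_allpairs mulnACA leq_mul//; last first.
    by rewrite [leqRHS]mulnC; exact: size_box_double.
  by move: Pi; rewrite mulSn addnC.
- split => [j jL g|j g x jL] /= [h [n [hP nB ->]]].
    exists h, n; split => //; first by apply: products_mono hP; rewrite addnS.
    by apply: box_mono nB; nia.
  rewrite {1}Sgens => /= xg.
  have nxB : n + p x \in B (c * (L + j.+1))%N.
    have -> : (c * (L + j.+1) = c * (L + j) + c)%N by nia.
    by apply: box_add => // y yT; exact: cgens.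
  exists (h * schreier n x)%g, (n + p x); split => //; last first.
    by rewrite /mk -[LHS]mulgA -[RHS]mulgA (schreierK n x).
  have xxs : schreier n x \in xs.
    rewrite mem_filter; apply/andP; split; last first.
      by apply/allpairsP; exists (n, x); split => //=; apply: BL nB; exact: ltnW.
    apply/asboolP; have -> : (2 * l + 1 = l + 1 + l)%N by lia.
    apply: word_ballM; last by apply: word_ballV => //; apply: Bball; exact: BL nxB.
    apply: word_ballM; last by apply: word_ball_gen; rewrite Sgens.
    by apply: Bball; apply: BL nB; exact: ltnW.
  (* [products] takes new factors on the left, hence the commutation. *)
  rewrite (kerC (PH _ _ hP) (xsH _ xxs)) addnS; exact: products_step.
- move=> x g [h [n [hP nB xE]]] [h' [n' [h'P n'B xgE]]].
  have mkball a b' : a \in P (i * L + L)%N -> b' \in B (c * (L + L))%N ->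
      word_ball S (I * L * (2 * l + 1) + l) (mk a b').
    move=> aP bB; apply: word_ballM; last by apply: Bball; exact: BL bB.
    apply: word_ball_mono (products_ball xsb aP).
    by rewrite leq_mul2r; apply/orP; right; nia.
  have -> : g = (x^-1 * (x * g))%g by rewrite mulKg.
  rewrite mul2n -addnn; apply: word_ballM; last by rewrite xgE; exact: mkball.
  by apply: word_ballV => //; rewrite xE; exact: mkball.
Qed.

Lemma chains_exist : exists2 C, (0 < C)%N & forall k, exists E e A,
  folner_chain S (2 ^ k) C (C * 2 ^ (k * (d + 2)) * k.+1) E e A.
Proof.
have [fS _ _] := hS; move/finite_seqP: fS => [gens Sgens].
have [s [b [ps sball]]] := short_section pM psurj hS t T.
have [c hc] := box_exhausts span [seq x + p g | g <- gens, x <- T].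
have cgens g x : g \in gens -> x \in T -> x + p g \in box t T c.
  by move=> gg xT; apply: hc; apply/allpairsP; exists (g, x).
(* There are at most [Q * L ^ d] Schreier generators at scale [L = 2 ^ k]. *)
pose Q := (size T * (4 * c).+1 ^ d * size gens)%N.
have [z hz] := exponential_dominates Q (d + 3).
pose m := (2 * c).+1.
exists (2 * (2 ^ z * (2 * (b * m) + 1) + b * m) + 2 * 3 ^ d)%N => [|k].
  by rewrite addn_gt0 [(0 < 2 * 3 ^ d)%N]muln_gt0 expn_gt0 orbT.
(* [I] is of order [L ^ d * k.+1], so that [2 ^ I] exceeds [(I * L).+1 ^ (Q * X)]: the base is at
   most 2 to the power [(z + (d + 3)) * k.+1], and [z] satisfies [Q * (z + (d + 3)) < 2 ^ z]. *)
pose L := (2 ^ k)%N; pose X := (2 ^ (k * d))%N; pose I := (2 ^ z * X * k.+1)%N.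
have L0 : (0 < L)%N by rewrite expn_gt0.
have X0 : (0 < X)%N by rewrite expn_gt0.
have [|E [e [A ch]]] := @chains_at_scale s b c L I gens ps sball Sgens cgens.
  have IL : ((I * L).+1 <= 2 ^ (z + k * d + k + k + 1))%N.
    rewrite addn1 expnS mul2n -addnn -addn1 leq_add ?expn_gt0//.
    rewrite !expnD -/X -/L /I -!mulnA !leq_mul2l (mulnC k.+1) leq_mul2l.
    by rewrite (ltn_expl k (isT : 1 < 2)%N) !orbT.
  apply: (@leq_ltn_trans ((2 ^ (z + k * d + k + k + 1)) ^ (Q * X))).
    apply: (@leq_trans ((I * L).+1 ^ (Q * X))); last by rewrite leq_wexp2r.
    have bd : ((4 * (c * L)).+1 ^ d <= (4 * c).+1 ^ d * X)%N.
      by rewrite /X expnM -expnMn leq_wexp2r// -/L; nia.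
    by rewrite leq_pexp2l// /Q [leqRHS]mulnAC leq_mul2r -mulnA leq_mul2l bd !orbT.
  rewrite -expnM ltn_exp2l//.
  have eb : (z + k * d + k + k + 1 <= (z + (d + 3)) * k.+1)%N by nia.
  rewrite /I mulnAC mulnA ltn_pmul2r//.
  apply: (@leq_ltn_trans (Q * (z + (d + 3)) * k.+1)); last by rewrite ltn_pmul2r.
  by rewrite mulnC -mulnA leq_mul2l eb orbT.
exists E, e, A; apply: folner_chain_mono ch; first by rewrite leq_addl.
have LE : (2 ^ (k * (d + 2)) = X * L * L)%N.
  by rewrite mulnDr expnD muln2 -addnn expnD mulnA.
rewrite LE.
apply: (@leq_trans (2 * (2 ^ z * (2 * (b * m) + 1) + b * m) * (X * L * L) * k.+1)).
  set l := (2 * (c * L)).+1.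
  have lm : (l <= m * L)%N by rewrite /l /m; nia.
  have bl : (b * l <= b * m * L)%N by rewrite -mulnA leq_mul2l lm orbT.
  have h1 : (I * L * (2 * (b * l) + 1) <=
      2 ^ z * (2 * (b * m) + 1) * (X * L * L) * k.+1)%N.
    have -> : (I * L * (2 * (b * l) + 1) =
        2 ^ z * (X * L * k.+1) * (2 * (b * l) + 1))%N by rewrite /I; ring.
    have -> : (2 ^ z * (2 * (b * m) + 1) * (X * L * L) * k.+1 =
        2 ^ z * (X * L * k.+1) * ((2 * (b * m) + 1) * L))%N by ring.
    by rewrite leq_mul2l; apply/orP; right; nia.
  have h2 : (b * l <= b * m * (X * L * L) * k.+1)%N.
    apply: (leq_trans bl).
    have -> : (b * m * (X * L * L) * k.+1 = b * m * L * (X * L * k.+1))%N by ring.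
    by rewrite leq_pmulr// !muln_gt0 X0 L0.
  by rewrite -!(mulnA 2) leq_mul2l !mulnDl leq_add.
by rewrite !leq_mul2r leq_addr !orbT.
Qed.
End ChainsExist.

(** * Rational rank *)

Section SpannedUpToFinite.
Variable N : zmodType.

(** The subgroup generated by the [t i] has finite index: [T] meets each of its cosets. *)
Definition spanned_up_to_finite (r : nat) : Prop :=
  exists (t : 'I_r -> N) (T : seq N), forall n, exists2 x, x \in T &
    exists v : 'I_r -> int, n = x + \sum_i t i *~ v i.

Definition Z_free r (t : 'I_r -> N) : Prop :=
  forall v : 'I_r -> int, \sum_i t i *~ v i = 0 -> forall i, v i = 0.

(** Euclidean division of coordinate [i0] by [a i0]: subtracting the quotient times the relation
    leaves a remainder with finitely many values, which joins the finite part. *)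
Lemma spanned_drop r (t : 'I_r.+1 -> N) (T : seq N) (a : 'I_r.+1 -> int) i0 :
  (forall n, exists2 x, x \in T &
    exists v : 'I_r.+1 -> int, n = x + \sum_i t i *~ v i) ->
  \sum_i t i *~ a i = 0 -> a i0 != 0 -> spanned_up_to_finite r.
Proof.
move=> span ta a0; exists (fun j => t (lift i0 j)).
exists [seq x + t i0 *+ k | x <- T, k <- iota 0 `|a i0|%N] => n.
have [x xT [v ->]] := span n.
pose q := (v i0 %/ a i0)%Z.
exists (x + t i0 *+ `|(v i0 %% a i0)%Z|%N).
  apply/allpairsP; exists (x, `|(v i0 %% a i0)%Z|%N); split => //=.
  by rewrite mem_iota /=; have := ltz_mod (v i0) a0; have := modz_ge0 (v i0) a0; lia.
exists (fun j => v (lift i0 j) - q * a (lift i0 j)).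
rewrite -addrA; congr (_ + _).
have qa : \sum_i t i *~ (q * a i) = 0.
  by under eq_bigr do rewrite mulrC mulrzA; rewrite -mulrz_suml ta mul0rz.
rewrite -[LHS]subr0 -[X in _ - X]qa -sumrB (bigD1_ord i0)//=.
congr (_ + _); last by apply: eq_bigr => j _; rewrite -mulrzBr.
rewrite -mulrzBr pmulrn; congr (_ *~ _).
by rewrite gez0_abs ?modz_ge0// {1}(divz_eq (v i0) (a i0)) -/q; ring.
Qed.

(** A minimal [r] works, since a nontrivial relation would lower it. *)
Lemma spanned_Z_free m : spanned_up_to_finite m ->
  exists r (t : 'I_r -> N) (T : seq N), Z_free t /\
    forall n, exists2 x, x \in T & exists v : 'I_r -> int, n = x + \sum_i t i *~ v i.
Proof.
move=> sm; have ex : exists r, `[< spanned_up_to_finite r >] by exists m; apply/asboolP.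
case: (ex_minnP ex) => r /asboolP[t [T span]] rmin.
exists r, t, T; split => // v tv i; apply/eqP/negPn/negP => vi.
case: r t span rmin v tv i vi => [|r] t span rmin v tv i vi; first by case: i vi.
have : (r.+1 <= r)%N; last by rewrite ltnn.
by apply: rmin; apply/asboolP; exact: spanned_drop span tv vi.
Qed.

Section Coordinates.
Variables (r : nat) (t : 'I_r -> N) (T : seq N).
Hypothesis tfree : Z_free t.
Hypothesis span : forall n, exists2 x, x \in T &
  exists v : 'I_r -> int, n = x + \sum_i t i *~ v i.

(** Among the multiples of [n] by [0, ..., size T], two have the same finite part; their difference
    lies in the span. *)
Lemma multiple_in_span n : exists w : nat * ('I_r -> int),
  (0 < w.1)%N /\ n *+ w.1 = \sum_i t i *~ w.2 i.
Proof.
have mult k : exists w : N * ('I_r -> int), w.1 \in T /\ n *+ k = w.1 + \sum_i t i *~ w.2 i.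
  by have [x xT [v E]] := span (n *+ k); exists (x, v).
have [w hw] := choice mult.
have : ~~ uniq [seq (w k).1 | k <- iota 0 (size T).+1].
  apply/negP => uw; have := uniq_leq_size (s2 := T) uw.
  rewrite size_map size_iota ltnn => sub; suff: false by [].
  by apply: sub => y /mapP[k _ ->]; case: (hw k).
move=> /(uniqPn 0)[i [j []]]; rewrite size_map size_iota => ij jT.
have nthE k : (k < (size T).+1)%N ->
    nth 0 [seq (w k).1 | k <- iota 0 (size T).+1] k = (w k).1.
  by move=> kT; rewrite (nth_map 0%N) ?size_iota// nth_iota.
rewrite !nthE//; last exact: ltn_trans jT.
move=> wij; exists ((j - i)%N, fun l => (w j).2 l - (w i).2 l) => /=.
split; first by rewrite subn_gt0.
rewrite mulrnBr ?(ltnW ij)//.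
have [_ ->] := hw j; have [_ ->] := hw i.
rewrite wij opprD addrACA subrr add0r -sumrB.
by apply: eq_bigr => l _; rewrite mulrzBr.
Qed.

Lemma rational_coordinates : exists phi : N -> 'rV[rat]_r,
  (forall x y, phi (x + y) = phi x + phi y) /\
  (forall i, phi (t i) = delta_mx 0 i).
Proof.
have [w hw] := choice multiple_in_span.
pose phi n : 'rV[rat]_r := \row_i (((w n).2 i)%:~R / ((w n).1)%:R).
(* The coordinates do not depend on the multiple chosen: cross-multiplying two relations for [n]
   gives a relation among the [t i], which [tfree] makes trivial. *)
have phiE n q v : (0 < q)%N -> n *+ q = \sum_i t i *~ v i ->
    phi n = \row_i ((v i)%:~R / q%:R).
  move=> q0 nq; apply/rowP => i; rewrite !mxE.
  have [w0 nw] := hw n.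
  have : (w n).2 i * q%:Z - v i * ((w n).1)%:Z = 0.
    apply: (tfree (v := fun i => (w n).2 i * q%:Z - v i * ((w n).1)%:Z)).
    under eq_bigr do rewrite mulrzBr !mulrzA.
    by rewrite sumrB -!mulrz_suml -nw -nq -!pmulrn -!mulrnA mulnC subrr.
  move=> /subr0_eq E; apply/eqP; rewrite eqr_div ?pnatr_eq0 -?lt0n//.
  have := congr1 (fun z : int => z%:~R : rat) E.
  by rewrite !intrM => ->.
exists phi; split => [x y|i].
  have [x0 xw] := hw x; have [y0 yw] := hw y.
  rewrite (phiE (x + y) ((w x).1 * (w y).1)%N
    (fun i => (w x).2 i * (w y).1%:Z + (w y).2 i * (w x).1%:Z)).
  - apply/rowP => i; rewrite !mxE rmorphD !rmorphM/=.
    by field; rewrite !pnatr_eq0 -!lt0n x0 y0.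
  - by rewrite muln_gt0 x0.
  - under eq_bigr do rewrite mulrzDr !mulrzA.
    by rewrite big_split/= -!mulrz_suml -xw -yw mulrnDl mulrnA -!pmulrn mulnC mulrnA.
rewrite (phiE (t i) 1%N (fun j => (j == i)%:Z)) ?mulr1n//.
  by apply/rowP => j; rewrite !mxE divr1 eqxx/= eq_sym.
rewrite (bigD1 i)//= eqxx mulr1z big1 ?addr0// => j /negPf ->.
by rewrite mulr0z.
Qed.

(** The universal property extends the coordinates to an additive map on [V] that sends the
    [tau (t i) 1] to the standard basis, so these vectors are free. *)
Lemma Z_free_le_Q_rank d : has_Q_rank N d -> (r <= d)%N.
Proof.
move=> [V [tau [[_ tauZ univ] <-]]].
have [phi [phiD phit]] := rational_coordinates.
have bi : biadditive (fun n (a : rat) => a *: phi n).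
  by split => [x y b|a x y]; rewrite ?phiD ?scalerDr ?scalerDl.
have [h [[hD htau] _]] := univ _ _ bi.
pose X := [tuple tau (t i) 1 | i < r].
have Xi (i : 'I_r) : X`_i = tau (t i) 1 by rewrite -tnth_nth tnth_mktuple.
have h0 : h 0 = 0 by apply: (addrI (h 0)); rewrite -hD !addr0.
have : free X.
  apply/freeP => k kX i.
  (* Additivity of [h] suffices: by [tauZ] the scalar [k i] moves inside [tau]. *)
  have : h (\sum_(i < r) k i *: X`_i) = \row_i k i.
    rewrite (big_morph h hD h0); apply/rowP => j; rewrite summxE mxE (bigD1 j)//=.
    rewrite Xi -tauZ htau mulr1 phit !mxE !eqxx mulr1 big1 ?addr0// => l lj.
    by rewrite Xi -tauZ htau phit !mxE eq_sym (negPf lj) andbF mulr0.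
  by rewrite kX h0 => /rowP/(_ i); rewrite !mxE.
by rewrite /free => /eqP; rewrite size_tuple => <-; exact: dimvS (subvf _).
Qed.

End Coordinates.
End SpannedUpToFinite.

(** * Abelianization *)

Section Abelianization.
Variable G : groupType.
Local Notation G' := (@derived_subgroup G).

Lemma generated_subgroup (A : set G) : is_subgroup (generated A).
Proof.
split => [|x y xA yA|x xA] B hB; have [[B1 BM BV] _] := hB => //.
  by apply: BM; [exact: xA|exact: yA].
by apply: BV; exact: xA.
Qed.

Lemma commg_derived (x y : G) : G' [~ x, y]%g.
Proof. by move=> B [_ sB]; apply: sB; exists x => //; exists y. Qed.

(** The choice depends only on the coset as a set, so it is constant on cosets; its fixed points
    will serve as the quotient group. *)
Definition coset_rep (g : G) : G := xget 1%g [set x | G' (x * g^-1)%g].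

Lemma coset_repP g : G' (coset_rep g * g^-1)%g.
Proof.
have [G1 _ _] := generated_subgroup [set [~ x, y]%g | x in setT & y in setT].
rewrite /coset_rep; case: xgetP => [y _ //|/(_ g)]; by rewrite /= mulgV.
Qed.

Lemma eq_coset_rep g h : G' (g * h^-1)%g -> coset_rep g = coset_rep h.
Proof.
have [_ GM GV] := generated_subgroup [set [~ x, y]%g | x in setT & y in setT].
move=> gh; congr xget; apply/seteqP; split => x /= xg.
  by have := GM _ _ xg gh; rewrite mulgA mulgVK.
by have := GM _ _ xg (GV _ gh); rewrite invgM invgK mulgA mulgVK.
Qed.

Lemma coset_rep_id g : coset_rep (coset_rep g) = coset_rep g.
Proof. exact: eq_coset_rep (coset_repP g). Qed.

Lemma coset_repC g h : coset_rep (g * h)%g = coset_rep (h * g)%g.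
Proof.
(* The commutator of the inverses is [(g * h) * (h * g)^-1]. *)
apply: eq_coset_rep; have := commg_derived g^-1%g h^-1%g.
by rewrite /commg /conjg !invgK invgM !mulgA.
Qed.

Lemma coset_repMl g h : coset_rep (coset_rep g * h)%g = coset_rep (g * h)%g.
Proof.
apply: eq_coset_rep; have := coset_repP g.
by rewrite invgM mulgA mulgK.
Qed.

Record abelianization : Type := Abelianization {
  abel_rep : G;
  _ : coset_rep abel_rep == abel_rep
}.

HB.instance Definition _ := [isSub for abel_rep].
HB.instance Definition _ := [Choice of abelianization by <:].

Definition abel (g : G) : abelianization :=
  @Abelianization (coset_rep g) (introT eqP (coset_rep_id g)).

Lemma abelK (a : abelianization) : abel (abel_rep a) = a.
Proof. by apply: val_inj => /=; apply/eqP; case: a. Qed.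

Lemma eq_abel g h : abel g = abel h <-> coset_rep g = coset_rep h.
Proof. by split => [/(congr1 abel_rep)|gh]//; exact: val_inj. Qed.

Definition abel_add a b := abel (abel_rep a * abel_rep b)%g.
Definition abel_opp a := abel (abel_rep a)^-1%g.

Lemma abel_addC : commutative abel_add.
Proof. by move=> a b; apply/eq_abel; exact: coset_repC. Qed.

Lemma abel_addE g h : abel_add (abel g) (abel h) = abel (g * h)%g.
Proof.
apply/eq_abel => /=.
by rewrite coset_repMl coset_repC coset_repMl coset_repC.
Qed.

Lemma abel_addA : associative abel_add.
Proof.
move=> a b c; rewrite -(abelK a) -(abelK b) -(abelK c) !abel_addE.
by rewrite mulgA.
Qed.

Lemma abel_add0 : left_id (abel 1%g) abel_add.
Proof. by move=> a; rewrite -(abelK a) abel_addE mul1g. Qed.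

Lemma abel_addN : left_inverse (abel 1%g) abel_opp abel_add.
Proof. by move=> a; rewrite -{2}(abelK a) abel_addE mulVg. Qed.

HB.instance Definition _ := GRing.isZmodule.Build abelianization
  abel_addA abel_addC abel_add0 abel_addN.

Lemma abelM g h : abel (g * h)%g = abel g + abel h.
Proof. by rewrite -abel_addE. Qed.

Lemma abel_eq0 g : abel g = 0 -> G' g.
Proof.
have [G1 GM GV] := generated_subgroup [set [~ x, y]%g | x in setT & y in setT].
move=> /eq_abel E; have := coset_repP 1%g; have := coset_repP g; rewrite E.
rewrite invg1 mulg1 => h1 h2.
by have := GM _ _ (GV _ h1) h2; rewrite invgM invgK mulgVK.
Qed.

End Abelianization.

(** * The compression bound for abelian-by-abelian groups *)

Section AbelianByAbelian.
Variables (R : realType) (N : zmodType) (G : groupType) (p : G -> N) (S : set G).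
Hypothesis pM : forall g h, p (g * h)%g = p g + p h.
Hypothesis psurj : forall n, exists g, p g = n.
Hypothesis kerC : forall g h, p g = 0 -> p h = 0 -> commute g h.
Hypothesis hS : finite_symmetric_generating S.

Lemma quotient_spanned : exists m, spanned_up_to_finite N m.
Proof.
have [fS _ gS] := hS; move/finite_seqP: fS => [gens Sgens].
exists (size gens), (fun i => p (tnth (in_tuple gens) i)), [:: 0] => n.
exists 0; first by rewrite inE.
have [g <-] := psurj n; have : generated S g by rewrite gS.
pose spanned := [set g | exists v : 'I_(size gens) -> int,
  p g = 0 + \sum_i p (tnth (in_tuple gens) i) *~ v i].
move=> /(_ spanned); apply; split; first split => /= [|x y [v xv] [w yw]|x [v xv]].
- by exists (fun=> 0); rewrite additive1// big1 ?addr0// => i _; rewrite mulr0z.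
- exists (fun i => v i + w i); rewrite pM xv yw !add0r -big_split.
  by apply: eq_bigr => i _; rewrite mulrzDr.
- exists (fun i => - v i); rewrite additiveV// xv !add0r -sumrN.
  by apply: eq_bigr => i _; rewrite mulrNz.
rewrite Sgens => s /= sg; have sI : (index s gens < size gens)%N by rewrite index_mem.
exists (fun j => (j == Ordinal sI)%:Z); rewrite add0r (bigD1 (Ordinal sI))//=.
rewrite eqxx mulr1z big1 ?addr0 => [|j /negPf ->]; last by rewrite mulr0z.
by rewrite (tnth_nth s)/= nth_index.
Qed.

(** The integer [r] is produced rather than given, so the bound also serves the metabelian case,
    where no rational rank is supplied. *)
Lemma compression_rate_ge : exists r : nat,
  (forall d, has_Q_rank N d -> (r <= d)%N) /\
  ((1 / (r%:R + 2))%:E <= Hilbert_compression_rate R S)%E.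
Proof.
have [m sm] := quotient_spanned.
have [r [t [T [tfree span]]]] := spanned_Z_free sm.
exists r; split => [d|]; first exact: (Z_free_le_Q_rank tfree span).
have [C C0 chains] := chains_exist pM psurj kerC hS span.
have -> : r%:R + 2 = (r + 2)%:R :> R by rewrite natrD.
by apply: (rate_from_chains R hS C0 _ chains); rewrite addn2.
Qed.

End AbelianByAbelian.

Theorem corollary16 (R : realType) :
  (forall (K N : zmodType) (G : groupType) (i : K -> G) (p : G -> N) (d : nat)
      (S : set G),
     abelian_extension i p -> has_Q_rank N d ->
     finite_symmetric_generating S ->
     ((1 / (d%:R + 2))%:E <= Hilbert_compression_rate R S)%E)
  /\
  (forall (G : groupType) (S : set G),
     metabelian G -> finite_symmetric_generating S ->
     (0 < Hilbert_compression_rate R S)%E).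
Proof.
split=> [K N G i p d S [[iM _] [pM psurj] ker_p] hd hS|G S mG hS].
  have kerC g h : p g = 0 -> p h = 0 -> commute g h.
    move=> pg ph.
    have [x _ <-] : range i g by rewrite ker_p.
    have [y _ <-] : range i h by rewrite ker_p.
    by rewrite /commute -!iM addrC.
  have [r [rd rate]] := compression_rate_ge R pM psurj kerC hS.
  apply: le_trans rate; rewrite lee_fin -!natrD !div1r lef_pV2 ?posrE ?ltr0n ?addn2//.
  by rewrite ler_nat !ltnS rd.
(* A metabelian group is an extension of its abelianization, with commuting kernel elements because
   the kernel lies in the derived subgroup. *)
have abel_surj (a : abelianization G) : exists g, abel g = a.
  by exists (abel_rep a); exact: abelK.
have kerC (g h : G) : abel g = 0 -> abel h = 0 -> commute g h.
  by move=> /abel_eq0 Gg /abel_eq0 Gh; exact: mG.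
have [r [_ rate]] := compression_rate_ge R (@abelM G) abel_surj kerC hS.
by apply: lt_le_trans rate; rewrite lte_fin divr_gt0// ltr_wpDl.
Qed.
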